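(* Let $X=(X,\|\cdot\|)$ be a Banach space, let $(A_m)_{m\in\mathbb N}$ be a sequence of bounded linear operators on $X$, and let $(\|\cdot\|_m)_{m\in\mathbb N}$ be a sequence of norms on $X$, each equivalent to $\|\cdot\|$. If $(A_m)_{m\in\mathbb N}$ admits a polynomial dichotomy with respect to the sequence of norms $\|\cdot\|_m$, with projections $P_m$ and $Q_m=\mathrm{Id}-P_m$, then for the closed subspace $Z=\operatorname{Im} Q_1$ the operator $T_Z\colon(\mathcal D(T_Z),\|\cdot\|_{T_Z})\to Y_0$ is invertible.
   Context: $\mathbb N=\{1,2,3,\dots\}$. Set $\mathcal A(m,n)=A_{m-1}\cdots A_n$ if $m>n$ and $\mathcal A(n,n)=\mathrm{Id}$. Polynomial dichotomy: $(A_m)_{m\in\mathbb N}$ admits a polynomial dichotomy with respect to the sequence of norms $\|\cdot\|_m$ if (i) there exist projections $P_m$, $m\in\mathbb N$, on $X$ with $A_mP_m=P_{m+1}A_m$ for all $m\in\mathbb N$, such that each map $A_m|_{\operatorname{Ker}P_m}\colon\operatorname{Ker}P_m\to\operatorname{Ker}P_{m+1}$ is invertible; and (ii) there exist $\lambda,D>0$ such that for all $x\in X$ and $m,n\in\mathbb N$: $\|\mathcal A(m,n)P_nx\|_m\le D(m/n)^{-\lambda}\|x\|_n$ for $m\ge n$, and $\|\mathcal A(m,n)Q_nx\|_m\le D(n/m)^{-\lambda}\|x\|_n$ for $m\le n$, where $Q_n=\mathrm{Id}-P_n$ and, for $m<n$, $\mathcal A(m,n)=(\mathcal A(n,m)|_{\operatorname{Ker}P_m})^{-1}\colon\operatorname{Ker}P_n\to\operatorname{Ker}P_m$.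 Sequence spaces: $Y$ is the Banach space of all sequences $\mathbf x=(x_m)_{m\in\mathbb N}\subset X$ with $\|\mathbf x\|_\infty:=\sup_{m\in\mathbb N}\|x_m\|_m<\infty$. For a closed subspace $Z\subset X$, $Y_Z=\{\mathbf x\in Y: x_1\in Z\}$, and $Y_0=Y_{\{0\}}$. Operator $T_Z$: $\mathcal D(T_Z)=\{\mathbf x\in Y_Z:\sup_{m\in\mathbb N}(m+1)\|x_{m+1}-A_mx_m\|_{m+1}<\infty\}$, and $T_Z\colon\mathcal D(T_Z)\to Y_0$ is given by $(T_Z\mathbf x)_1=0$, $(T_Z\mathbf x)_{m+1}=(m+1)(x_{m+1}-A_mx_m)$ for $m\in\mathbb N$. The space $\mathcal D(T_Z)$ is equipped with the graph norm $\|\mathbf x\|_{T_Z}=\|\mathbf x\|_\infty+\|T_Z\mathbf x\|_\infty$, for which it is a Banach space and $T_Z$ is bounded. Invertible means bijective (hence with bounded inverse). *)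

(* Defs.v *)
(* The index set {1, 2, 3, ...} is encoded by [nat] with a shift by one: the
   entry [k] of a family is its (k+1)-st member, so that [A k] is A_{k+1},
   [nu k] is the norm ||.||_{k+1} and the first term of a sequence [x] is
   [x 0].  A coefficient equal to the index m thus reads [m.+1%:R]. *)
From HB Require Import structures.
From mathcomp Require Import all_boot all_order all_algebra.
From mathcomp Require Import all_classical all_reals all_analysis.
Set Implicit Arguments.
Unset Strict Implicit.
Unset Printing Implicit Defensive.
Import Order.TTheory GRing.Theory Num.Theory.
Import numFieldNormedType.Exports.
Local Open Scope classical_set_scope.
Local Open Scope ring_scope.

Section PolynomialDichotomy.
Context {R : realType} {X : completeNormedModType R}.

Record is_norm (nu : X -> R) : Prop := IsNorm {
  is_norm_triangle : forall x y, nu (x + y) <= nu x + nu y;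
  is_norm_homog : forall (a : R) x, nu (a *: x) = `|a| * nu x;
  is_norm_definite : forall x, nu x = 0 -> x = 0 }.

Definition equivalent_to_norm (nu : X -> R) : Prop :=
  exists c C : R,
    [/\ 0 < c, 0 < C & forall x, c * `|x| <= nu x /\ nu x <= C * `|x|].

Definition kernel (f : X -> X) : set X := f @^-1` [set 0].

Definition compl_proj (P : X -> X) : X -> X := fun x => x - P x.

(* A_{n+d-1} ... A_n *)
Fixpoint forward_cocycle (A : nat -> X -> X) (n d : nat) : X -> X :=
  if d is d'.+1 then A (n + d')%N \o forward_cocycle A n d' else id.

(* For m < n this is the inverse of A(n, m) restricted to Ker P_m; it is
   meaningful on the image Ker P_n of that restriction only. *)
Definition cocycle (A P : nat -> X -> X) (m n : nat) : X -> X :=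
  if (n <= m)%N then forward_cocycle A n (m - n)
  else 'pinv_(fun=> 0) (kernel (P m)) (forward_cocycle A m (n - m)).

(* The projections are only required to be linear and idempotent: their
   boundedness follows from the first estimate with m = n. *)
Record polynomial_dichotomy (A : nat -> {linear X -> X}) (nu : nat -> X -> R)
    (P : nat -> {linear X -> X}) : Prop := PolynomialDichotomy {
  dich_proj : forall m, idempotent_fun (P m);
  dich_comm : forall m x, A m (P m x) = P m.+1 (A m x);
  dich_ker : forall m, set_bij (kernel (P m)) (kernel (P m.+1)) (A m);
  dich_bounds : exists lambda D : R, [/\ 0 < lambda, 0 < D,
    forall (x : X) (m n : nat), (n <= m)%N ->
      nu m (cocycle A P m n (P n x))
        <= D * (m.+1%:R / n.+1%:R) `^ (- lambda) * nu n x &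
    forall (x : X) (m n : nat), (m <= n)%N ->
      nu m (cocycle A P m n (compl_proj (P n) x))
        <= D * (n.+1%:R / m.+1%:R) `^ (- lambda) * nu n x] }.

Local Open Scope ereal_scope.

(* The supremum norm, with value +oo on the sequences that are not in Y. *)
Definition sup_norm (nu : nat -> X -> R) (x : nat -> X) : \bar R :=
  ereal_sup (range (fun m => (nu m (x m))%:E)).

Definition spaceY (nu : nat -> X -> R) : set (nat -> X) :=
  [set x | sup_norm nu x < +oo].

Definition spaceYZ (nu : nat -> X -> R) (Z : set X) : set (nat -> X) :=
  [set x | spaceY nu x /\ Z (x 0%N)].

Definition domT (A : nat -> X -> X) (nu : nat -> X -> R) (Z : set X) :
    set (nat -> X) :=
  [set x | spaceYZ nu Z x /\
    ereal_sup (range (fun m =>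
      (m.+2%:R * nu m.+1 (x m.+1 - A m (x m)))%R%:E)) < +oo].

(* The formula defining T_Z; Z only enters through the domain. *)
Definition opT (A : nat -> X -> X) (x : nat -> X) : nat -> X :=
  fun k => if k is m.+1 then (m.+2%:R *: (x m.+1 - A m (x m)))%R else 0%R.

Definition graph_norm (A : nat -> X -> X) (nu : nat -> X -> R)
    (x : nat -> X) : \bar R :=
  sup_norm nu x + sup_norm nu (opT A x).

(* T_Z is a bijection of its domain onto Y_0, and its inverse is bounded from
   the supremum norm to the graph norm. *)
Definition T_invertible (A : nat -> X -> X) (nu : nat -> X -> R)
    (Z : set X) : Prop :=
  set_bij (domT A nu Z) (spaceYZ nu [set 0%R]) (opT A) /\
  exists C : R, forall y, spaceYZ nu [set 0%R] y ->
    graph_norm A nu ('pinv_(fun=> fun=> 0%R) (domT A nu Z) (opT A) y)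
      <= C%:E * sup_norm nu y.

End PolynomialDichotomy.

(* Main.v *)
Require Import Defs.
From HB Require Import structures.
From mathcomp Require Import all_boot all_order all_algebra.
From mathcomp Require Import all_classical all_reals all_analysis.
From mathcomp Require Import ring lra.
Set Implicit Arguments.
Unset Strict Implicit.
Unset Printing Implicit Defensive.
Import Order.TTheory GRing.Theory Num.Theory.
Import numFieldNormedType.Exports.
Local Open Scope classical_set_scope.
Local Open Scope ring_scope.

(** The solution of [opT A x = y] with [y 0 = 0] is explicit: it is obtained
    from the Green function of the dichotomy,

      [x m = \sum_k k.+1%:R^-1 *: green m k (y k)],

    where [green m k] carries the stable part [P k] of a vector forward when
    [k <= m] and minus its unstable part [Q k = id - P k] backward when
    [m < k].  The map [A m] turns [green m k] into [green m.+1 k], except that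
    at [k = m.+1] it goes from [- Q k] to [P k], a jump equal to the identity
    ([green_step]).  Hence [x m.+1 - A m (x m)] is the single term
    [m.+2%:R^-1 *: y m.+1], which is the equation to solve.  Moreover [x 0] is
    a sum of unstable parts only, because [P 0 (y 0) = 0]; it therefore lies
    in the closed subspace [kernel (P 0) = Z].

    The dichotomy bounds the [k]-th term by [D * sup |y|] times [k.+1%:R^-1]
    times a power decay in the ratio of the two indices.  These weights have
    a sum bounded uniformly in [m] ([decay_weight_sum_le]): this is the
    discrete form of the integrals of [(s / t) `^ lambda / s] over [0 < s <= t]
    and of [(t / s) `^ lambda / s] over [s >= t], both equal to [lambda^-1].
    It is the factor [k.+1] in [opT] that provides the measure [ds / s].  So
    the series converges, its sum is a bounded sequence, and the bound is a
    bound on the inverse.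

    For uniqueness, a difference [d] of two solutions is an orbit of the
    homogeneous equation that is bounded and starts in [kernel (P 0)].  Every
    [d m] is then unstable, and going back from [m] to [0] gives
    [nu 0 (d 0) <= D * m.+1%:R `^ (- lambda) * sup |d|], which tends to [0]
    ([bounded_orbit_eq0]). *)

(** * Summation of the decay weights *)

Section DecayWeights.
Context {R : realType}.
Implicit Types (lambda : R) (m n k : nat).

Lemma powR_le1 (a r : R) : 0 <= r -> 0 <= a -> a <= 1 -> a `^ r <= 1.
Proof.
by move=> r0 a0 a1; have := ge0_ler_powR r0 a0 ler01 a1; rewrite powR1.
Qed.

Definition decay_weight lambda m k : R :=
  if (k <= m)%N then (m.+1%:R / k.+1%:R) `^ (- lambda)
  else (k.+1%:R / m.+1%:R) `^ (- lambda).

(** A discrete primitive of the weights: increasing in [j], with values in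
    [0, 2], and built from the two decaying branches, which are glued at
    [j = m.+1] where both have the value [1].  Its increments dominate the
    weights, so that their sum telescopes. *)
Definition decay_potential lambda m j : R :=
  if (j <= m.+1)%N then (j%:R / m.+1%:R) `^ lambda
  else 2 - (j%:R / m.+1%:R) `^ (- lambda).

(** With [u = k.+1%:R^-1] and [q = (1 - u) `^ lambda], the inequality
    [1 - u <= expR (- u)] gives [q * (1 + lambda * u) <= 1], which bounds the
    gap [1 - q] from below by [lambda * u / (1 + lambda)]. *)
Lemma invS_le_powR_gap lambda k : 0 < lambda ->
  k.+1%:R^-1 <= (1 + lambda) / lambda * (1 - (k%:R / k.+1%:R) `^ lambda).
Proof.
move=> l0; set u : R := k.+1%:R^-1.
have u0 : 0 < u by rewrite invr_gt0.
have u1 : u <= 1 by rewrite invf_le1// ler1n.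
have -> : k%:R / k.+1%:R = 1 - u :> R.
  by rewrite /u -[in k.+1%:R]natr1; field; rewrite natr1 pnatr_eq0.
set q := (_ `^ lambda).
have q_exp : q * (1 + lambda * u) <= 1.
  have q_le : q <= expR (- (lambda * u)).
    rewrite -mulrN mulrC expRM.
    apply: ge0_ler_powR; rewrite ?nnegrE ?expR_ge0 //.
    - exact: ltW.
    - by rewrite subr_ge0.
    - exact: expR_ge1Dx.
  apply: (@le_trans _ _ (expR (- (lambda * u)) * expR (lambda * u))).
    apply: ler_pM => //; first exact: powR_ge0.
      by rewrite addr_ge0// mulr_ge0// ltW.
    exact: expR_ge1Dx.
  by rewrite -expRD addNr expR0.
have q0 : 0 <= q by exact: powR_ge0.
rewrite -(ler_pM2l l0) mulrA mulrCA divff ?gt_eqF// mulr1.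
have lu0 : 0 < lambda * u by exact: mulr_gt0.
have lu1 : lambda * u <= lambda by rewrite ger_pMr.
nra.
Qed.

(** On each branch the increment of the potential is the weight times a gap
    between powers of [k%:R / k.+1%:R]: [1 - q] for [k <= m], and [q^-1 - 1],
    which is larger, for [m < k]. *)
Lemma decay_weight_le_gap lambda m k : 0 < lambda ->
  k.+1%:R^-1 * decay_weight lambda m k <= (1 + lambda) / lambda *
    (decay_potential lambda m k.+1 - decay_potential lambda m k).
Proof.
move=> l0; have gap := @invS_le_powR_gap lambda k l0.
have c0 : 0 < (1 + lambda) / lambda by rewrite divr_gt0// addr_gt0.
have split_ratio : k%:R / m.+1%:R = k.+1%:R / m.+1%:R * (k%:R / k.+1%:R) :> R.
  by rewrite [RHS]mulrC mulrA divfK ?pnatr_eq0.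
rewrite /decay_weight /decay_potential; case: (leqP k m) => [km|mk].
  rewrite ltnS km (leq_trans km (leqnSn m)) split_ratio [in X in _ - X]powRM//.
  have -> : (m.+1%:R / k.+1%:R) `^ (- lambda) =
      (k.+1%:R / m.+1%:R) `^ lambda :> R.
    rewrite -[m.+1%:R / _]invf_div.
    by rewrite -[(_ / _)^-1]powR_inv1 ?divr_ge0// -powRrM mulN1r opprK.
  set t := (_ `^ lambda); rewrite -[X in X - _]mulr1 -mulrBr mulrC mulrCA.
  by rewrite ler_wpM2l// powR_ge0.
rewrite ltnS leqNgt mk /=.
have k0 : (0 < k)%N by exact: leq_ltn_trans mk.
(* The two branches of the potential agree at [k = m.+1]. *)
have -> : (if (k <= m.+1)%N then (k%:R / m.+1%:R) `^ lambda
    else 2 - (k%:R / m.+1%:R) `^ (- lambda)) =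
    2 - (k%:R / m.+1%:R) `^ (- lambda) :> R.
  case: leqP => // km; have -> : k = m.+1 by apply/eqP; rewrite eqn_leq km.
  by rewrite divff ?pnatr_eq0// !powR1; ring.
rewrite split_ratio [in X in _ - (_ - X)]powRM//.
set s := (_ `^ (- lambda)); rewrite powRN.
set q := (_ `^ lambda) in gap *.
have q0 : 0 < q by rewrite powR_gt0// divr_gt0// ltr0n.
have s0 : 0 <= s by exact: powR_ge0.
have q1 : q <= 1.
  rewrite powR_le1 ?(ltW l0) ?divr_ge0//.
  by rewrite ler_pdivrMr// mul1r ler_nat.
have qV : 1 - q <= q^-1 - 1.
  have : 0 <= (1 - q) ^+ 2 / q by rewrite divr_ge0 ?sqr_ge0// ltW.
  have -> : (1 - q) ^+ 2 / q = q^-1 - 1 - (1 - q) by field; rewrite gt_eqF.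
  by rewrite subr_ge0.
have -> : 2 - s - (2 - s * q^-1) = s * (q^-1 - 1) by ring.
rewrite mulrC mulrCA ler_wpM2l//; apply: (le_trans gap).
by rewrite ler_wpM2l// ltW.
Qed.

Lemma decay_weight_sum_le lambda m n : 0 < lambda ->
  \sum_(0 <= k < n) k.+1%:R^-1 * decay_weight lambda m k
    <= 2 * ((1 + lambda) / lambda).
Proof.
move=> l0; have c0 : 0 < (1 + lambda) / lambda by rewrite divr_gt0// addr_gt0.
apply: (@le_trans _ _ (\sum_(0 <= k < n) (1 + lambda) / lambda *
    (decay_potential lambda m k.+1 - decay_potential lambda m k))).
  by apply: ler_sum => k _; exact: decay_weight_le_gap.
rewrite -mulr_sumr telescope_sumr// mulrC ler_wpM2r ?(ltW c0)//.
rewrite {2}/decay_potential leq0n mul0r powR0 ?gt_eqF// subr0 /decay_potential.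
case: leqP => [nm|_]; last by rewrite gerBl powR_ge0.
apply: (@le_trans _ _ 1); last by lra.
rewrite powR_le1 ?(ltW l0) ?divr_ge0//.
by rewrite ler_pdivrMr// mul1r ler_nat.
Qed.

Lemma decay_weight_ge0 lambda m k : 0 <= decay_weight lambda m k.
Proof. by rewrite /decay_weight; case: ifP => _; exact: powR_ge0. Qed.

End DecayWeights.

(** * Norms equivalent to the ambient norm *)

Section EquivalentNorm.
Context {R : realType} {X : completeNormedModType R} {nu : X -> R}.
Context (norm_nu : is_norm nu) (equiv_nu : equivalent_to_norm nu).

Lemma is_norm_ge0 x : 0 <= nu x.
Proof.
have [c [C [c0 _ /(_ x)[cx _]]]] := equiv_nu.
by apply: le_trans cx; rewrite mulr_ge0// ltW.
Qed.

Lemma is_norm0 : nu 0 = 0.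
Proof. by rewrite -(scale0r 0) (is_norm_homog norm_nu) normr0 mul0r. Qed.

Lemma is_normN x : nu (- x) = nu x.
Proof. by rewrite -scaleN1r (is_norm_homog norm_nu) normrN1 mul1r. Qed.

Lemma is_norm_sum_le (f : nat -> X) n :
  nu (\sum_(0 <= k < n) f k) <= \sum_(0 <= k < n) nu (f k).
Proof.
elim: n => [|n IHn]; first by rewrite !big_geq// is_norm0.
rewrite !big_nat_recr//=; apply: le_trans (is_norm_triangle norm_nu _ _) _.
by rewrite lerD2r.
Qed.

(** An equivalent norm is continuous for the ambient topology, hence its
    closed balls are closed. *)
Lemma is_norm_lim_le (u : nat -> X) l M :
  u @ \oo --> l -> (forall n, nu (u n) <= M) -> nu l <= M.
Proof.
move=> ul uM; have [c [C [c0 C0 equiv]]] := equiv_nu.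
apply/ler_addgt0Pr => e e0.
have eC0 : 0 < e / C by exact: divr_gt0.
have /cvgrPdist_lt/(_ _ eC0)[N _ /(_ N (leqnn N)) /= lN] := ul.
rewrite -(subrK (u N) l) addrC.
apply: le_trans (is_norm_triangle norm_nu _ _) _; apply: lerD; first exact: uM.
apply: le_trans (equiv _).2 _; rewrite mulrC -ler_pdivlMr//.
exact: ltW.
Qed.

Lemma is_norm_series_cvg (f : nat -> X) M :
  (forall n, \sum_(0 <= k < n) nu (f k) <= M) -> cvgn (series f).
Proof.
move=> fM; have [c [C [c0 C0 equiv]]] := equiv_nu.
apply: normed_cvg; apply: nondecreasing_is_cvgn.
  apply/nondecreasing_seqP => n.
  by rewrite /normed_series_of /series/= big_nat_recr//= lerDl normr_ge0.
exists (c^-1 * M) => _ [n _ <-].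
rewrite /normed_series_of /series/= -ler_pdivrMl ?invr_gt0// invrK.
apply: le_trans (fM n); rewrite mulr_sumr; apply: ler_sum => k _.
by case: (equiv (f k)).
Qed.

End EquivalentNorm.

(** * Bounded sequences *)

Section SupNorm.
Context {R : realType} {X : completeNormedModType R} {nu : nat -> X -> R}.

Lemma ereal_sup_lty (u : nat -> R) :
  (ereal_sup (range (fun m => (u m)%:E)) < +oo)%E <->
  exists M, forall m, u m <= M.
Proof.
split=> [|[M uM]]; last first.
  apply: (@le_lt_trans _ _ M%:E); last exact: ltry.
  by apply: ge_ereal_sup => _ [m _ <-]; rewrite lee_fin.
set s := ereal_sup _ => s_lty; have le_s m : ((u m)%:E <= s)%E.
  by apply: ereal_sup_ubound; exists m.
case: s s_lty le_s => [M _ uM| // |_ /(_ 0%N)//].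
by exists M => m; rewrite -lee_fin.
Qed.

Context (nu_ge0 : forall m x, 0 <= nu m x).

Lemma sup_norm_le (x : nat -> X) (M : R) :
  (sup_norm nu x <= M%:E)%E <-> forall m, nu m (x m) <= M.
Proof.
split=> [xM m|xM].
  rewrite -lee_fin; apply: le_trans xM.
  by apply: ereal_sup_ubound; exists m.
by apply: ge_ereal_sup => _ [m _ <-]; rewrite lee_fin.
Qed.

Lemma sup_norm_fin (x : nat -> X) : spaceY nu x ->
  exists2 M : R, 0 <= M & sup_norm nu x = M%:E.
Proof.
rewrite /spaceY/= => x_lty.
have x_ge m : ((nu m (x m))%:E <= sup_norm nu x)%E.
  by apply: ereal_sup_ubound; exists m.
case: (sup_norm nu x) x_lty x_ge => [M _ xM| // |_ /(_ 0%N)//].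
by exists M => //; have := xM 0%N; rewrite lee_fin; exact: le_trans.
Qed.

End SupNorm.

(** * Cocycles and the Green function *)

Section Cocycle.
Context {R : realType} {X : completeNormedModType R}.
Context {A : nat -> {linear X -> X}} {nu : nat -> X -> R}.
Context {P : nat -> {linear X -> X}}.
Context (dich : polynomial_dichotomy A nu P).
Implicit Types (m n k d : nat) (x z : X).

Local Notation Q k := (compl_proj (P k)).
Local Notation Ker k := (Defs.kernel (P k)).

Lemma forward_cocycleSl (B : nat -> X -> X) n d z :
  forward_cocycle B n d.+1 z = forward_cocycle B n.+1 d (B n z).
Proof. by elim: d => [|d IHd]; [rewrite /= addn0|rewrite /= -addSnnS -IHd]. Qed.

Lemma forward_cocycle_kernel m d z :
  Ker m z -> Ker (m + d) (forward_cocycle A m d z).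
Proof.
elim: d m z => [|d IHd] m z Kz; first by rewrite addn0.
rewrite forward_cocycleSl -addSnnS; apply: IHd.
by have [sub _ _] := dich_ker dich m; exact: sub.
Qed.

Lemma forward_cocycle_inj m d :
  {in Ker m &, injective (forward_cocycle A m d)}.
Proof.
elim: d => [|d IHd] x z Kx Kz //= Axz; apply: IHd => //.
have [_ inj _] := dich_ker dich (m + d); apply: inj => //.
- by rewrite inE; apply: forward_cocycle_kernel; rewrite inE in Kx.
- by rewrite inE; apply: forward_cocycle_kernel; rewrite inE in Kz.
Qed.

Lemma forward_cocycle_surj m d :
  Ker (m + d) `<=` [set forward_cocycle A m d x | x in Ker m].
Proof.
elim: d => [|d IHd] z; first by rewrite addn0 => Kz; exists z.
rewrite addnS => Kz; have [_ _ /(_ _ Kz)[w Kw <-]] := dich_ker dich (m + d).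
by have [v Kv <-] := IHd _ Kw; exists v.
Qed.

Lemma cocycle_refl n z : cocycle A P n n z = z.
Proof. by rewrite /cocycle leqnn subnn. Qed.

Lemma cocycle_step m n z : (n <= m)%N ->
  A m (cocycle A P m n z) = cocycle A P m.+1 n z.
Proof.
by move=> nm; rewrite /cocycle nm (leq_trans nm (leqnSn m)) subSn//= subnKC.
Qed.

(** Since the forward cocycle is a bijection between the kernels, the backward
    cocycle is a genuine inverse of it there; this and
    [cocycle_back_unique] replace its definition by a partial inverse. *)
Lemma cocycle_backP m n z : (m <= n)%N -> Ker n z ->
  Ker m (cocycle A P m n z) /\
  forward_cocycle A m (n - m) (cocycle A P m n z) = z.
Proof.
rewrite leq_eqVlt => /predU1P[<- Kz|mn Kz].
  by rewrite cocycle_refl subnn.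
have [w Kw wz] : [set forward_cocycle A m (n - m) x | x in Ker m] z.
  by apply: forward_cocycle_surj; rewrite subnKC// ltnW.
rewrite /cocycle leqNgt mn /= -wz pinvKV// ?inE//.
exact: forward_cocycle_inj.
Qed.

Lemma cocycle_back_unique m n x : (m <= n)%N -> Ker m x ->
  cocycle A P m n (forward_cocycle A m (n - m) x) = x.
Proof.
move=> mn Kx; have Kn : Ker n (forward_cocycle A m (n - m) x).
  by rewrite -[in P n](subnKC mn); exact: forward_cocycle_kernel.
have [Kc eq_c] := cocycle_backP mn Kn.
by apply: (@forward_cocycle_inj m (n - m)); rewrite ?inE.
Qed.

Lemma cocycle_back_step m n z : (m < n)%N -> Ker n z ->
  A m (cocycle A P m n z) = cocycle A P m.+1 n z.
Proof.
move=> mn Kz; have [Kc eq_c] := cocycle_backP (ltnW mn) Kz.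
have [sub _ _] := dich_ker dich m.
rewrite -[in RHS]eq_c -subnSK// forward_cocycleSl cocycle_back_unique//.
exact: sub.
Qed.

Lemma kernel_compl_proj n x : Ker n (Q n x).
Proof.
rewrite /Defs.kernel/= /compl_proj linearB/=.
by rewrite (dich_proj dich n x : P n (P n x) = P n x) subrr.
Qed.

Lemma compl_proj_id n z : Ker n z -> Q n z = z.
Proof. by rewrite /Defs.kernel/= /compl_proj => ->; rewrite subr0. Qed.

Lemma range_compl_proj n : range (Q n) = Ker n.
Proof.
apply/seteqP; split=> [_ [x _ <-]|z Kz]; first exact: kernel_compl_proj.
by exists z => //; exact: compl_proj_id.
Qed.

(** The minus sign on the backward branch makes the jump across [k = m]
    equal to [P k + Q k], the identity. *)
Definition green m k z : X :=
  if (k <= m)%N then cocycle A P m k (P k z) else - cocycle A P m k (Q k z).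

(** The cocycle property carries each branch from [m] to [m.+1]; only the
    index [k = m.+1] changes branch. *)
Lemma green_step m k z :
  A m (green m k z) = green m.+1 k z - (if k == m.+1 then z else 0).
Proof.
rewrite /green; case: (ltngtP k m.+1) => [km|mk|->].
- by rewrite -ltnS km subr0 cocycle_step.
- rewrite leqNgt (ltn_trans _ mk)//= linearN subr0 cocycle_back_step//.
    exact: ltn_trans mk.
  exact: kernel_compl_proj.
- rewrite ltnn linearN cocycle_back_step ?cocycle_refl//=.
    by rewrite /compl_proj opprB.
  exact: kernel_compl_proj.
Qed.

Definition green_sum (y : nat -> X) m : nat -> X :=
  series (fun k => k.+1%:R^-1 *: green m k (y k)).

Definition green_solution (y : nat -> X) m : X := limn (green_sum y m).

(** The equation already holds exactly for the partial sums that contain the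
    index [m.+1], so that only continuity is needed in the limit. *)
Lemma green_sum_step y m n : (m.+1 < n)%N ->
  green_sum y m.+1 n - A m (green_sum y m n) = m.+2%:R^-1 *: y m.+1.
Proof.
move=> mn; rewrite /green_sum /series/= linear_sum/= -sumrB.
rewrite (bigD1_seq m.+1) ?mem_index_iota ?iota_uniq//= big1 => [|k /negbTE kNm].
  by rewrite linearZ/= green_step eqxx scalerBr addr0 opprB addrC subrK.
by rewrite linearZ/= green_step kNm subr0 subrr.
Qed.

(** The last estimate has the decay moved to the left as a growth factor: it
    shows that a vector of the unstable space at time 0 can only have a bounded
    orbit if it vanishes. *)
Lemma green_bound :
  (forall m x, 0 <= nu m x) -> (forall m x, nu m (- x) = nu m x) ->
  exists lambda D : R, [/\ 0 < lambda, 0 < D,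
    forall m k z, nu m (green m k z) <= D * decay_weight lambda m k * nu k z &
    forall m z, Ker m z ->
      m.+1%:R `^ lambda * nu 0%N (cocycle A P 0 m z) <= D * nu m z].
Proof.
move=> nu_ge0 nuN; have [lambda [D [l0 D0 fwd bwd]]] := dich_bounds dich.
exists lambda, D; split=> // [m k z|m z Kz].
  rewrite /green /decay_weight; case: leqP => km; first exact: fwd.
  by rewrite nuN; apply: bwd; exact: ltnW.
have := bwd z 0%N m (leq0n m).
rewrite compl_proj_id// divr1 powRN => bwd_z.
by rewrite -ler_pdivlMl ?powR_gt0// mulrA [_^-1 * _]mulrC.
Qed.

Context (bounded_A : forall m, bounded_near (A m) (nbhs (0 : X))).
Context (norm_nu : forall m, is_norm (nu m)).
Context (equiv_nu : forall m, equivalent_to_norm (nu m)).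

Let nu_ge0 m x : 0 <= nu m x.
Proof. exact: is_norm_ge0. Qed.

Let nuN m x : nu m (- x) = nu m x.
Proof. exact: is_normN. Qed.

(** The stable estimate at equal indices bounds [P n] for [nu n]. *)
Lemma continuous_proj n : continuous (P n).
Proof.
have [lambda [D [l0 D0 fwd _]]] := dich_bounds dich.
have [c [C [c0 C0 equiv]]] := equiv_nu n.
apply: bounded_linear_continuous; apply/linear_boundedP.
near=> r => x; have := fwd x n n (leqnn n).
rewrite cocycle_refl divff ?pnatr_eq0// powR1 mulr1 => Px.
apply: (@le_trans _ _ (c^-1 * D * C * `|x|)).
  rewrite -!mulrA ler_pdivlMl//; apply: le_trans (equiv _).1 _.
  by apply: le_trans Px _; rewrite ler_pM2l//; case: (equiv x).
by apply: ler_wpM2r => //; near: r; apply: nbhs_pinfty_ge; exact: num_real.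
Unshelve. all: by end_near. Qed.

Lemma closed_kernel_proj n : closed (Ker n).
Proof.
apply: preimage_closed => [x _|]; first exact: continuous_proj.
exact/accessible_closed_set1/hausdorff_accessible/norm_hausdorff.
Qed.

(** * Solving the inhomogeneous equation *)

Lemma green_sum_bound : exists2 K : R, 0 <= K & forall y M, 0 <= M ->
  (forall k, nu k (y k) <= M) -> forall m n,
  \sum_(0 <= k < n) nu m (k.+1%:R^-1 *: green m k (y k)) <= K * M.
Proof.
have [lambda [D [l0 D0 greenD _]]] := green_bound nu_ge0 nuN.
exists (D * (2 * ((1 + lambda) / lambda))) => [|y M M0 yM m n].
  by rewrite !mulr_ge0// ?invr_ge0 ?addr_ge0// ltW.
apply: (@le_trans _ _ (D * M *
    \sum_(0 <= k < n) k.+1%:R^-1 * decay_weight lambda m k)).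
  rewrite mulr_sumr; apply: ler_sum => k _.
  rewrite (is_norm_homog (norm_nu m)) ger0_norm ?invr_ge0//.
  rewrite mulrCA ler_wpM2l ?invr_ge0//; apply: le_trans (greenD m k (y k)) _.
  rewrite -mulrA -[leRHS]mulrA ler_wpM2l ?(ltW D0)// mulrC.
  by rewrite ler_wpM2r// decay_weight_ge0.
rewrite [leRHS]mulrAC; apply: ler_wpM2l; last exact: decay_weight_sum_le.
by rewrite mulr_ge0// ltW.
Qed.

Lemma green_solution_cvg y M m : 0 <= M -> (forall k, nu k (y k) <= M) ->
  green_sum y m @ \oo --> green_solution y m.
Proof.
move=> M0 yM; have [K _ sumK] := green_sum_bound.
by apply: (is_norm_series_cvg (equiv_nu m)) => n; exact: sumK yM _ n.
Qed.

Lemma green_solution_bound : exists2 K : R, 0 <= K & forall y M, 0 <= M ->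
  (forall k, nu k (y k) <= M) -> forall m, nu m (green_solution y m) <= K * M.
Proof.
have [K K0 sumK] := green_sum_bound; exists K => // y M M0 yM m.
have sol_cvg := @green_solution_cvg y M m M0 yM.
apply: (is_norm_lim_le (norm_nu m) (equiv_nu m) sol_cvg) => n.
apply: le_trans (sumK y M M0 yM m n).
exact: (is_norm_sum_le (norm_nu m)).
Qed.

Lemma green_solution_step y M m : 0 <= M -> (forall k, nu k (y k) <= M) ->
  green_solution y m.+1 - A m (green_solution y m) = m.+2%:R^-1 *: y m.+1.
Proof.
move=> M0 yM.
have cvg_step : green_sum y m.+1 n - A m (green_sum y m n) @[n --> \oo] -->
    green_solution y m.+1 - A m (green_solution y m).
  apply: cvgB; first exact: green_solution_cvg yM.
  apply: continuous_cvg; last exact: green_solution_cvg yM.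
  exact: bounded_linear_continuous.
apply: (cvg_unique _ cvg_step) => //.
apply: cvg_near_cst; near=> n; apply: green_sum_step.
by near: n; exact: nbhs_infty_gt.
Unshelve. all: by end_near. Qed.

Lemma green_solution_kernel0 y M : 0 <= M -> (forall k, nu k (y k) <= M) ->
  y 0%N = 0 -> Ker 0%N (green_solution y 0%N).
Proof.
move=> M0 yM y0.
have sol_cvg := @green_solution_cvg y M 0%N M0 yM.
apply: (closed_cvg _ (@closed_kernel_proj 0%N) _ _ sol_cvg).
near=> n; rewrite /Defs.kernel/= /green_sum /series/= linear_sum big1// => k _.
rewrite linearZ/= /green leqn0; case: eqP => [->|_].
  by rewrite y0 cocycle_refl !linear0.
(* At time 0 every other term is transported backward inside the kernels. *)
have [Kc _] := cocycle_backP (leq0n k) (kernel_compl_proj k (y k)).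
by rewrite linearN/= (Kc : P 0%N _ = 0) oppr0 scaler0.
Unshelve. all: by end_near. Qed.

(** * Uniqueness and invertibility *)

(** An orbit that starts in the unstable space stays there, and its initial
    value is recovered by going back from time [m], which contracts by
    [m.+1%:R `^ (- lambda)] up to a constant; if the orbit is bounded, this forces the initial
    value to vanish. *)
Lemma bounded_orbit_eq0 (d : nat -> X) M :
  (forall m, d m.+1 = A m (d m)) -> Ker 0%N (d 0%N) ->
  (forall m, nu m (d m) <= M) -> forall m, d m = 0.
Proof.
move=> d_step K0 dM; have [lambda [D [l0 D0 _ back]]] := green_bound nu_ge0 nuN.
have d_fwd m : d m = forward_cocycle A 0 m (d 0%N).
  by elim: m => // m IHm; rewrite d_step IHm.
have d0_le m : m.+1%:R `^ lambda * nu 0%N (d 0%N) <= D * M.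
  have Km : Ker m (d m) by rewrite d_fwd; exact: forward_cocycle_kernel.
  apply: le_trans (_ : _ <= D * nu m (d m)) _; last by rewrite ler_pM2l.
  have := back m _ Km; congr (_ * nu _ _ <= _).
  by rewrite d_fwd -[in forward_cocycle A 0 m](subn0 m) cocycle_back_unique.
suff d0 : d 0%N = 0 by elim=> // m IHm; rewrite d_step IHm linear0.
apply: (is_norm_definite (norm_nu 0%N)); apply/eqP; rewrite eq_le nu_ge0 andbT.
rewrite leNgt; apply/negP => d0_gt0.
have M0 : 0 <= M by exact: le_trans (dM 0%N).
(* If [d 0] did not vanish, [m.+1%:R `^ lambda] would be bounded by [t]. *)
pose t := D * M / nu 0%N (d 0%N).
have t0 : 0 <= t by rewrite divr_ge0// ?mulr_ge0// ltW.
have := archi_boundP (powR_ge0 t lambda^-1).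
set N := Num.Def.archi_bound _ => tN.
have : t < N.+1%:R `^ lambda.
  rewrite -[ltLHS]powRr1// -[X in t `^ X](mulVf (lt0r_neq0 l0)) powRrM.
  apply: gt0_ltr_powR; rewrite ?nnegrE ?powR_ge0//.
  by apply: lt_trans tN _; rewrite ltr_nat.
by rewrite ltNge /t ler_pdivlMr// d0_le.
Qed.

Local Notation Z := (Ker 0%N).
Local Notation T := (opT A).

(** The second condition in the domain says that [opT A x] is bounded; the
    missing first entry of [opT A x] is [0]. *)
Lemma domTP (x : nat -> X) : domT A nu Z x <->
  [/\ spaceY nu x, Z (x 0%N) & spaceY nu (T x)].
Proof.
have nuT m : nu m.+1 (T x m.+1) = m.+2%:R * nu m.+1 (x m.+1 - A m (x m)).
  by rewrite /= (is_norm_homog (norm_nu _)) ger0_norm.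
split=> [[[Yx Zx] /ereal_sup_lty[M TM]]|[Yx Zx /ereal_sup_lty[M TM]]].
  split=> //; apply/ereal_sup_lty; exists M => -[|m]; last by rewrite nuT.
  rewrite /= (is_norm0 (norm_nu _)); apply: le_trans (TM 0%N).
  by rewrite mulr_ge0.
by split=> //; apply/ereal_sup_lty; exists M => m; rewrite -nuT.
Qed.

Lemma opT_inj : {in domT A nu Z &, injective T}.
Proof.
move=> x x'; rewrite !inE => /domTP[/ereal_sup_lty[M xM] Zx _].
move=> /domTP[/ereal_sup_lty[M' xM'] Zx' _] eqT.
apply/funext => m; apply/eqP; rewrite -subr_eq0; apply/eqP; move: m.
apply: (@bounded_orbit_eq0 (fun m => x m - x' m) (M + M')) => [m||m].
- have m2 : (m.+2%:R : R) != 0 by rewrite pnatr_eq0.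
  have /(congr1 (@^~ m.+1)) /= /(scalerI m2) eqm := eqT.
  rewrite -[x m.+1](subrK (A m (x m))) eqm linearB addrAC.
  by rewrite [_ - x' m.+1]addrAC subrr add0r addrC.
- by rewrite /Defs.kernel/= linearB/= (Zx : P _ _ = 0) (Zx' : P _ _ = 0) subrr.
- apply: le_trans (is_norm_triangle (norm_nu m) _ _) _.
  by rewrite nuN lerD.
Qed.

Lemma green_solution_spec : exists2 K : R, 0 <= K & forall y,
  spaceYZ nu [set 0] y -> [/\ domT A nu Z (green_solution y),
    T (green_solution y) = y &
    (sup_norm nu (green_solution y) <= K%:E * sup_norm nu y)%E].
Proof.
have [K K0 solK] := green_solution_bound; exists K => // y [Yy y0].
have [M M0 supM] := sup_norm_fin nu_ge0 Yy.
have yM k : nu k (y k) <= M by move: k; apply/sup_norm_le; rewrite supM.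
have solKM := solK y M M0 yM.
have Ty : T (green_solution y) = y.
  apply/funext => -[|m]; first by rewrite y0.
  rewrite /= (green_solution_step m M0 yM) scalerA divff ?pnatr_eq0//.
  by rewrite scale1r.
split=> //.
- apply/domTP; rewrite Ty; split=> //.
    by apply/ereal_sup_lty; exists (K * M).
  exact: green_solution_kernel0 yM y0.
- by rewrite supM -EFinM; apply/sup_norm_le.
Qed.

Lemma opT_invertible : T_invertible A nu Z.
Proof.
have [K K0 spec] := green_solution_spec.
have bij : set_bij (domT A nu Z) (spaceYZ nu [set 0]) T.
  split; [|exact: opT_inj|].
  - by move=> x /domTP[_ _ YTx].
  - by move=> y Yy; have [dom Ty _] := spec y Yy; exists (green_solution y).
split=> //; exists (K + 1) => y Yy; have [dom Ty solK] := spec y Yy.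
have -> : 'pinv_(fun=> fun=> 0) (domT A nu Z) T y = green_solution y.
  by rewrite -[in LHS]Ty pinvKV// ?inE//; exact: opT_inj.
rewrite /graph_norm Ty; have [M M0 supM] := sup_norm_fin nu_ge0 Yy.1.
rewrite supM -EFinM mulrDl mul1r EFinD; apply: leeD => //.
by rewrite EFinM -supM.
Qed.

End Cocycle.

Theorem theorem2 (R : realType) (X : completeNormedModType R)
    (A : nat -> {linear X -> X}) (nu : nat -> X -> R)
    (P : nat -> {linear X -> X})
    (hA : forall m : nat, bounded_near (A m) (nbhs (0 : X)))
    (hnorm : forall m : nat, is_norm (nu m))
    (hequiv : forall m : nat, equivalent_to_norm (nu m))
    (hdich : polynomial_dichotomy A nu P) :
  let Z : set X := range (compl_proj (P 0%N)) in
  closed Z /\ T_invertible A nu Z.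
Proof.
rewrite /= (range_compl_proj hdich); split.
  exact: closed_kernel_proj hdich hequiv 0%N.
exact: opT_invertible hdich hA hnorm hequiv.
Qed.
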